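(* Let $a,b>0$, $0\leq v\leq 1$, and let $N$ be a nonnegative integer. Put $c=a^{-1}b$ and $f(u)=S\left(c^{r_{0}(u)}\right)a^{1-u}b^{u}$ for $u\in[0,1]$. Then $$(1-v)a+vb\ \geq\ S\left(c^{r_{0}(v)}\right)a^{1-v}b^{v}+\sum_{n=0}^{N-1}r_{n}(v)\sum_{k=1}^{2^{n}}\Delta_{f}(n,k)\,\chi_{\left(\frac{k-1}{2^{n}},\frac{k}{2^{n}}\right)}(v)$$ and $$(1-v)a+vb\ \leq\ a+b-a^{v}b^{1-v}S\left(c^{r_{0}(v)}\right)-\sum_{n=0}^{N-1}r_{n}(v)\sum_{k=1}^{2^{n}}\Delta_{f}(n,2^{n}-k+1)\,\chi_{\left(\frac{k-1}{2^{n}},\frac{k}{2^{n}}\right)}(v).$$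
   Context: $S$ is the Specht ratio: $S(t)=\dfrac{t^{1/(t-1)}}{e\ln t^{1/(t-1)}}$ for $t>0$, $t\neq1$, and $S(1)=\lim_{t\to1}S(t)=1$. The functions $r_n:[0,1]\to\mathbb{R}$ are defined recursively by $r_0(v)=\min\{v,1-v\}$ and $r_n(v)=\min\{2r_{n-1}(v),1-2r_{n-1}(v)\}$ for $n\ge 1$. For a function $f$ on $[0,1]$, $\Delta_f(n,k)=f\left(\frac{k-1}{2^n}\right)+f\left(\frac{k}{2^n}\right)-2f\left(\frac{2k-1}{2^{n+1}}\right)$. $\chi_I$ is the characteristic function of the interval $I$. A sum $\sum_{n=0}^{N-1}$ is zero when $N=0$. *)

(* Defs.v *)
From HB Require Import structures.
From mathcomp Require Import all_boot all_order all_algebra.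
From mathcomp Require Import all_classical all_reals all_analysis.

Set Implicit Arguments.
Unset Strict Implicit.
Unset Printing Implicit Defensive.

Import Order.TTheory GRing.Theory Num.Theory.

Local Open Scope classical_set_scope.
Local Open Scope ring_scope.

(* The Specht ratio, meaningful for [0 < t]; the formula is singular at [t = 1],
   where the value is the limit 1. *)
Definition specht (R : realType) (t : R) : R :=
  if t == 1 then 1
  else t `^ (1 / (t - 1)) / (expR 1 * ln (t `^ (1 / (t - 1)))).

Fixpoint rfun (R : realType) (n : nat) (v : R) : R :=
  match n with
  | 0 => Num.min v (1 - v)
  | m.+1 => Num.min (2 * rfun m v) (1 - 2 * rfun m v)
  end.

(* [k] ranges over 1, ..., 2 ^ n; the subtractions are in [R], not truncated. *)
Definition Delta (R : realType) (f : R -> R) (n k : nat) : R :=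
  f ((k%:R - 1) / 2 ^+ n) + f (k%:R / 2 ^+ n)
  - 2 * f ((2 * k%:R - 1) / 2 ^+ n.+1).

Definition open_dyadic (R : realType) (n k : nat) : set R :=
  `](k%:R - 1) / 2 ^+ n, k%:R / 2 ^+ n[%classic.

(* Main.v *)
Require Import Defs.
From HB Require Import structures.
From mathcomp Require Import all_boot all_order all_algebra.
From mathcomp Require Import all_classical all_reals all_analysis.
From mathcomp Require Import zify ring lra.

Set Implicit Arguments.
Unset Strict Implicit.
Unset Printing Implicit Defensive.

Import Order.TTheory GRing.Theory Num.Theory.
Import numFieldNormedType.Exports.

Local Open Scope classical_set_scope.
Local Open Scope ring_scope.

(** Let [f u] be the function S(c^r_0(u)) a^(1-u) b^u; it satisfies [f 0 = a]
    and [f 1 = b].  The functions [rfun n] are the tent functions of the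
    Faber-Schauder system (distance of 2^n v to the nearest integer), and
    [Delta f n k] is the corresponding second difference of [f].  Hence
    subtracting from the chord (1-v) f(0) + v f(1) the first [N] layers of the
    double sum leaves exactly the piecewise linear interpolant of [f] at the
    points j / 2^N ([faber_schauder]).  The first inequality therefore says
    that [f] lies below all its dyadic interpolants, and this holds as soon as
    [f] is convex on [0, 1/2] and on [1/2, 1] and satisfies the midpoint
    inequality 2 f(1/2) <= f(0) + f(1) ([faber_schauder_le]).  Convexity on each
    half suffices when 1/2 is a node, that is for N >= 1; only N = 0 uses the
    midpoint inequality, and [f] does have a concave kink at 1/2 if a and b
    differ.

    Convexity on the halves comes from that of K(x) = ln S(e^x).  This function
    is even, and with L = ln c one has f(u) = a exp (K(r_0(u) |L|) + u L), where
    r_0 is affine on each half.  For x > 0, with E = e^x, the inequality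
    K''(x) >= 0 follows from the two estimates x sqrt E <= E - 1 and
    2 (E - 1) <= x (E + 1) ([ddlnspecht_ge0]); the bounds 0 <= K(x) <= x give
    continuity at 0.

    The midpoint inequality comes from S(t) <= (t + 1)^2 / (4 t)
    ([specht_le_kantorovich]): at t = sqrt c it yields
    2 f(1/2) <= a (t + 1)^2 / 2 <= a (1 + t^2) = a + b.

    The second inequality is the first one at 1 - v: the reflection preserves
    [rfun n] and exchanges the dyadic intervals k and 2^n - k + 1. *)

(** * The Faber-Schauder expansion on dyadic points *)

Section FaberSchauder.
Variable R : realType.
Implicit Types (f : R -> R) (v : R).

(** Cells are closed and indexed from 0, so that a dyadic [v] lies in two of
    them; the cell [j] is the closure of [open_dyadic n j.+1]. *)
Definition in_dyadic (n j : nat) v :=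
  (j < 2 ^ n)%N && (j%:R <= 2 ^+ n * v <= j%:R + 1).

Definition dyadic_chord f (n j : nat) v : R :=
  (j%:R + 1 - 2 ^+ n * v) * f (j%:R / 2 ^+ n)
  + (2 ^+ n * v - j%:R) * f ((j%:R + 1) / 2 ^+ n).

(** Bisection also covers [v = 1], where the integer part of 2^n v would be
    one too large to index a cell. *)
Lemma dyadic_cell n v : 0 <= v <= 1 -> exists j, in_dyadic n j v.
Proof.
move=> /andP[v0 v1]; rewrite /in_dyadic.
elim: n => [|n [j /and3P[jn jX Xj]]].
  by exists 0%N => //; rewrite expr0 mul1r add0r v0 v1.
have [Xm|mX] := leP (2 ^+ n.+1 * v) (j.*2%:R + 1).
  exists j.*2; rewrite expnS mul2n ltn_double jn /=.
  by rewrite Xm andbT; move: jX; rewrite exprS -mul2n natrM; lra.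
exists j.*2.+1; rewrite expnS mul2n ltn_Sdouble jn /=.
rewrite -natr1 (ltW mX) /=.
by move: Xj; rewrite exprS -mul2n natrM; lra.
Qed.

Lemma natr_half (j : nat) : j%:R = (odd j)%:R + 2 * (j./2)%:R :> R.
Proof. by rewrite -natrM -natrD mul2n odd_double_half. Qed.

Lemma in_dyadic_half n j v : in_dyadic n.+1 j v -> in_dyadic n j./2 v.
Proof.
move=> /andP[jn jv]; apply/andP; split.
  by move: jn; rewrite expnS; lia.
move: jv; rewrite exprS (natr_half j).
by case: (odd j) => /=; lra.
Qed.

(** [rfun n] is a tent over each cell: doubling the distance to the nearest
    integer and folding it at 1/2 gives the distance of the doubled point. *)
Lemma rfun_dyadic n j v : in_dyadic n j v ->
  rfun n v = Num.min (2 ^+ n * v - j%:R) (j%:R + 1 - 2 ^+ n * v).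
Proof.
elim: n j => [|n IHn] j jv /=.
  move: jv => /andP[]; case: j => // _ _.
  by rewrite expr0 mul1r subr0 add0r.
rewrite (IHn _ (in_dyadic_half jv)); move: jv => /andP[_].
rewrite exprS (natr_half j).
set X := 2 ^+ n * v; rewrite -mulrA -/X; set i := (j./2)%:R : R.
have minE (x y : R) : Num.min x y = if x <= y then x else y.
  by rewrite minEle.
case: (odd j) => /= /andP[h1 h2].
- rewrite [Num.min (X - i) _]min_r; last lra.
  by rewrite minC; congr Num.min; ring.
- rewrite [Num.min (X - i) _]min_l; last lra.
  by congr Num.min; ring.
Qed.

Lemma rfun_ge0 n v : 0 <= v <= 1 -> 0 <= rfun n v.
Proof.
move=> /(dyadic_cell n)[j jv]; rewrite (rfun_dyadic jv).
by case/and3P: jv => _ h1 h2; rewrite le_min !subr_ge0 h1 h2.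
Qed.

Lemma open_dyadicE n k v :
  open_dyadic n k v = (k%:R - 1 < 2 ^+ n * v < k%:R) :> Prop.
Proof.
rewrite /open_dyadic /= in_itv /=.
by rewrite ltr_pdivrMr ?exprn_gt0// ltr_pdivlMr ?exprn_gt0// (mulrC v).
Qed.

(** At the common endpoint of two cells every indicator vanishes, but so does
    [rfun n v]; this is why open intervals are harmless in the double sum. *)
Lemma dyadic_layerE (D : nat -> R) n j v : in_dyadic n j v ->
  rfun n v * (\sum_(1 <= k < (2 ^ n).+1) D k * \1_(open_dyadic n k) v)
  = rfun n v * D j.+1.
Proof.
move=> jv; have [->|r0] := eqVneq (rfun n v) 0; first by rewrite !mul0r.
congr (_ * _); move: r0; rewrite (rfun_dyadic jv).
case/and3P: jv => jn jX Xj r0.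
have {jX}jX : j%:R < 2 ^+ n * v.
  rewrite lt_neqAle jX andbT; apply: contra r0 => /eqP <-.
  by rewrite subrr min_l// -addrA subrKC.
have {Xj}Xj : 2 ^+ n * v < j%:R + 1.
  rewrite lt_neqAle Xj andbT; apply: contra r0 => /eqP ->.
  by rewrite subrr min_r// addrAC subrr add0r.
rewrite (bigD1_seq j.+1) ?iota_uniq ?mem_index_iota//= big1 ?addr0; last first.
  move=> k kj; rewrite indicE memNset ?mulr0//.
  rewrite open_dyadicE => /andP[h1 h2]; case/eqP: kj.
  have : (j%:R : R) < k%:R by apply: lt_trans h2.
  have : (k%:R : R) < (j + 2)%:R by rewrite natrD; lra.
  by rewrite !ltr_nat; lia.
by rewrite indicE mem_set ?mulr1// open_dyadicE -natr1 addrK jX Xj.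
Qed.

(** On one cell, subtracting the tent [rfun N] times the second difference of
    [f] replaces the chord of the cell by the chords of its two halves. *)
Lemma faber_schauder f N j v : in_dyadic N j v ->
  (1 - v) * f 0 + v * f 1
  - \sum_(0 <= n < N) rfun n v *
      \sum_(1 <= k < (2 ^ n).+1) Delta f n k * \1_(open_dyadic n k) v
  = dyadic_chord f N j v.
Proof.
rewrite /dyadic_chord; elim: N j => [|N IHN] j jv.
  move: jv => /andP[]; case: j => // _ _.
  by rewrite big_nil expr0 mul1r !subr0 add0r !divr1.
have hv := in_dyadic_half jv.
rewrite big_nat_recr//= opprD addrA (IHN _ hv).
rewrite (dyadic_layerE _ hv) (rfun_dyadic hv) /Delta -[j./2.+1%:R]natr1 addrK.
have := jv => /andP[_].
rewrite !exprS (natr_half j).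
have P0 : (2 : R) ^+ N != 0 by rewrite expf_neq0.
set X := 2 ^+ N * v; rewrite -mulrA -/X; set i := (j./2)%:R : R.
have -> : (2 * (i + 1) - 1) / (2 * 2 ^+ N) = (1 + 2 * i) / (2 * 2 ^+ N).
  by congr (_ / _); ring.
(* The parity of [j] tells which half of the parent cell [v] lies in, hence
   which slope of the tent applies. *)
case: (odd j) => /= /andP[h1 h2].
- rewrite [Num.min (X - i) _]min_r; last lra.
  have -> : (1 + 2 * i + 1) / (2 * 2 ^+ N) = (i + 1) / 2 ^+ N by field.
  by ring.
- rewrite [Num.min (X - i) _]min_l; last lra.
  have -> : (0 + 2 * i) / (2 * 2 ^+ N) = i / 2 ^+ N by field.
  rewrite add0r [2 * i + 1]addrC.
  by ring.
Qed.

Lemma convex_chord f (lo hi x y t : R) :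
  convex_function (`[lo, hi]%classic : set R^o) f ->
  lo <= x <= hi -> lo <= y <= hi -> 0 <= t <= 1 ->
  f (t * x + (1 - t) * y) <= t * f x + (1 - t) * f y.
Proof.
move=> cvx xI yI /andP[t0 t1].
have := cvx (Itv01 t0 t1) x y; rewrite !convRE; apply.
- by rewrite inE /= in_itv.
- by rewrite inE /= in_itv.
Qed.

(** From level 1 on, 1/2 is a node, so no cell straddles it and convexity on
    the halves is enough. *)
Lemma le_dyadic_chord f N j v :
  convex_function (`[0, 2^-1]%classic : set R^o) f ->
  convex_function (`[2^-1, 1]%classic : set R^o) f ->
  in_dyadic N.+1 j v -> f v <= dyadic_chord f N.+1 j v.
Proof.
move=> cvxl cvxr jv; have P0 : (0 : R) < 2 ^+ N.+1 by rewrite exprn_gt0.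
case/and3P: jv => jn jX Xj.
set t := j%:R + 1 - 2 ^+ N.+1 * v.
have t01 : 0 <= t <= 1 by rewrite /t; lra.
set x : R := j%:R / 2 ^+ N.+1; set y : R := (j%:R + 1) / 2 ^+ N.+1.
have -> : dyadic_chord f N.+1 j v = t * f x + (1 - t) * f y.
  by rewrite /dyadic_chord -/x -/y /t; congr (_ + _ * _); ring.
have -> : v = t * x + (1 - t) * y.
  by rewrite /t /x /y; field; rewrite gt_eqF.
have half : 2^-1 = 2 ^+ N / 2 ^+ N.+1 :> R.
  by rewrite exprS; field; rewrite expf_neq0.
have xy : x <= y by rewrite ler_pM2r ?invr_gt0// lerDl.
have [jlo|jhi] := ltnP j (2 ^ N).
- have y2 : y <= 2^-1.
    by rewrite half ler_pM2r ?invr_gt0// -natrX natr1 ler_nat.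
  have x_ge0 : 0 <= x by rewrite divr_ge0 ?exprn_ge0.
  apply: (convex_chord cvxl) => //.
    by rewrite x_ge0 (le_trans xy).
  by rewrite y2 (le_trans x_ge0).
- have x2 : 2^-1 <= x by rewrite half ler_pM2r ?invr_gt0// -natrX ler_nat.
  have y1 : y <= 1 by rewrite ler_pdivrMr// mul1r -natrX natr1 ler_nat.
  apply: (convex_chord cvxr) => //.
    by rewrite x2 (le_trans xy).
  by rewrite y1 (le_trans x2).
Qed.

Lemma faber_schauder_le f N v :
  convex_function (`[0, 2^-1]%classic : set R^o) f ->
  convex_function (`[2^-1, 1]%classic : set R^o) f ->
  2 * f 2^-1 <= f 0 + f 1 -> 0 <= v <= 1 ->
  f v + \sum_(0 <= n < N) rfun n v *
      \sum_(1 <= k < (2 ^ n).+1) Delta f n k * \1_(open_dyadic n k) v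
  <= (1 - v) * f 0 + v * f 1.
Proof.
move=> cvxl cvxr mid v01; rewrite -lerBrDr.
(* At level 0 the chord lies above the level 1 interpolant, the difference
   being [rfun 0 v] times the nonnegative second difference of [f]. *)
case: N => [|N].
  have [j jv] := dyadic_cell 1 v01.
  apply: le_trans (le_dyadic_chord cvxl cvxr jv) _.
  rewrite -(faber_schauder f jv) big_nil big_nat1 lerB//.
  rewrite big_nat1 mulr_ge0 ?rfun_ge0//.
  rewrite mulr_ge0// /Delta subrr mul0r !divr1 expr1.
  have -> : (2 * 1 - 1) / 2 = 2^-1 :> R by field.
  by rewrite subr_ge0.
have [j jv] := dyadic_cell N.+1 v01.
by rewrite (faber_schauder f jv) le_dyadic_chord.
Qed.

Lemma rfun_onem n v : rfun n (1 - v) = rfun n v.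
Proof.
elim: n => [|n IHn] /=; last by rewrite IHn.
by rewrite subKr minC.
Qed.

Lemma open_dyadic_onem n k v : (k <= 2 ^ n)%N ->
  \1_(open_dyadic n (2 ^ n - k + 1)) v = \1_(open_dyadic n k) (1 - v) :> R.
Proof.
move=> kn; rewrite !indicE; congr ((_ : bool)%:R); apply/idP/idP.
all: rewrite !inE !open_dyadicE natrD natrB// natrX; lra.
Qed.

Lemma layer_onem f n v :
  \sum_(1 <= k < (2 ^ n).+1) Delta f n (2 ^ n - k + 1) * \1_(open_dyadic n k) v
  = \sum_(1 <= k < (2 ^ n).+1) Delta f n k * \1_(open_dyadic n k) (1 - v).
Proof.
rewrite big_nat_rev /=; apply: eq_big_nat => k /andP[k1 kn].
have -> : (1 + (2 ^ n).+1 - k.+1)%N = (2 ^ n - k + 1)%N by lia.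
by rewrite open_dyadic_onem//; congr (Delta f n _ * _); lia.
Qed.

End FaberSchauder.

(** * The logarithm of the Specht ratio *)

Section LogSpecht.
Variable R : realType.
Implicit Types x y : R.

(** The generating function of the Bernoulli numbers, away from [x = 0].  It is
    the logarithm of t^(1/(t-1)) at t = e^x. *)
Definition bernoulli_gf x : R := x / (expR x - 1).

(** ln S(e^x), by [specht_expR] below.  With h = [bernoulli_gf x] the Specht
    ratio is e^h / (e h). *)
Definition lnspecht x : R :=
  if x == 0 then 0 else bernoulli_gf x - 1 - ln (bernoulli_gf x).

Lemma expRm1_neq0 x : x != 0 -> expR x - 1 != 0.
Proof. by move=> x0; rewrite subr_eq0 -expR0 (inj_eq (@expR_inj R)). Qed.

Lemma bernoulli_gf_gt0 x : x != 0 -> 0 < bernoulli_gf x.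
Proof.
rewrite /bernoulli_gf neq_lt => /orP[x0|x0].
  by rewrite nmulr_rgt0// invr_lt0 subr_lt0 expR_lt1.
by rewrite divr_gt0// subr_gt0 expR_gt1.
Qed.

Lemma bernoulli_gfN x : x != 0 -> bernoulli_gf (- x) = bernoulli_gf x * expR x.
Proof.
move=> x0; have e0 : expR x != 0 by rewrite expR_eq0.
have d0 := expRm1_neq0 x0; rewrite /bernoulli_gf expRN; field.
by rewrite d0 e0 mulN1r -opprB oppr_eq0 d0.
Qed.

Lemma bernoulli_gfNE x : x != 0 -> bernoulli_gf (- x) = bernoulli_gf x + x.
Proof.
by move=> x0; rewrite bernoulli_gfN// /bernoulli_gf; field; exact: expRm1_neq0.
Qed.

(** With h = [bernoulli_gf x], passing to [- x] adds [x] both to h and to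
    ln h. *)
Lemma lnspechtN x : lnspecht (- x) = lnspecht x.
Proof.
rewrite /lnspecht oppr_eq0; case: eqVneq => // x0.
rewrite {2}bernoulli_gfN// lnM ?posrE ?bernoulli_gf_gt0 ?expR_gt0// expRK.
rewrite bernoulli_gfNE//.
by ring.
Qed.

Lemma lnspecht_norm x : lnspecht `|x| = lnspecht x.
Proof. by case: (ger0P x) => // _; rewrite lnspechtN. Qed.

Lemma specht_expR x : specht (expR x) = expR (lnspecht x).
Proof.
rewrite /specht /lnspecht -[in X in _ == X]expR0 (inj_eq (@expR_inj R)).
case: eqVneq => [_|x0]; first by rewrite expR0.
rewrite -expRM mulrA mulr1 -/(bernoulli_gf x) expRK !expRB.
rewrite lnK ?posrE ?bernoulli_gf_gt0//.
by rewrite invfM mulrA.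
Qed.

(** This bound and the next one squeeze [lnspecht] at 0 from the right. *)
Lemma lnspecht_ge0 x : 0 <= lnspecht x.
Proof.
rewrite /lnspecht; case: eqVneq => // /bernoulli_gf_gt0 h0.
have := @le_ln1Dx R (bernoulli_gf x - 1).
rewrite ltrBrDr addNr subrKC => /(_ h0).
by rewrite subr_ge0.
Qed.

(** For x > 0 the value h = [bernoulli_gf x] is at most 1, so h - 1 is
    nonpositive, while [bernoulli_gf (- x)] = h e^x is at least 1, so
    - ln h <= x. *)
Lemma lnspecht_le x : 0 <= x -> lnspecht x <= x.
Proof.
rewrite /lnspecht le_eqVlt eq_sym; case: eqVneq => [->//|x0] /= xpos.
have b0 := bernoulli_gf_gt0 x0.
have b1 : bernoulli_gf x <= 1.
  rewrite ler_pdivrMr ?subr_gt0 ?expR_gt1// mul1r lerBrDl.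
  exact: expR_ge1Dx.
have : 1 <= bernoulli_gf (- x).
  rewrite /bernoulli_gf -mulrNN -invrN opprB opprK.
  rewrite ler_pdivlMr ?subr_gt0 ?expR_lt1 ?oppr_lt0//.
  by have := expR_ge1Dx (- x); lra.
rewrite bernoulli_gfN// => /ln_ge0; rewrite lnM ?posrE ?expR_gt0// expRK; lra.
Qed.

Definition dlnspecht x : R :=
  (expR x - 1)^-1 - x * expR x / (expR x - 1) ^+ 2 - x^-1
  + expR x / (expR x - 1).

Definition ddlnspecht x : R :=
  (x ^+ 2)^-1 - 3 * expR x / (expR x - 1) ^+ 2
  + x * expR x * (expR x + 1) / (expR x - 1) ^+ 3.

Lemma is_derive_lnspecht x : 0 < x -> is_derive x 1 lnspecht (dlnspecht x).
Proof.
move=> x0; have d0 : 0 < expR x - 1 by rewrite subr_gt0 expR_gt1.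
apply: (@near_eq_is_derive _ _ _
    (fun y : R => y * (expR y - 1)^-1 - 1 - (ln y - ln (expR y - 1)))).
  near=> y.
  have y0 : 0 < y by near: y; exact: lt_nbhsr.
  by rewrite /lnspecht gt_eqF// -ln_div// posrE ?subr_gt0 ?expR_gt1.
have D1 : is_derive x 1 (fun y : R => expR y - 1) (expR x).
  by apply: is_derive_eq; rewrite subr0.
have Dl : is_derive x 1 (@ln R \o (fun y : R => expR y - 1))
    ((expR x - 1)^-1 * expR x).
  exact: (@is_derive1_comp R (@ln R) (fun y : R => expR y - 1) x _ _
    (is_derive1_ln d0) D1).
have Dln : is_derive x 1 (@ln R) x^-1 by exact: is_derive1_ln.
have Dinv : is_derive x 1 (fun y : R => (expR y - 1)^-1)
    (- (expR x - 1) ^- 2 *: expR x).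
  by apply: is_deriveV; rewrite gt_eqF.
apply: is_derive_eq.
rewrite /dlnspecht /GRing.scale /=; field.
by rewrite !gt_eqF.
Unshelve. all: by end_near.
Qed.

Lemma is_derive_dlnspecht x : 0 < x -> is_derive x 1 dlnspecht (ddlnspecht x).
Proof.
move=> x0; have d0 : 0 < expR x - 1 by rewrite subr_gt0 expR_gt1.
have D1 : is_derive x 1 (fun y : R => expR y - 1) (expR x).
  by apply: is_derive_eq; rewrite subr0.
have Dinv : is_derive x 1 (fun y : R => (expR y - 1)^-1)
    (- (expR x - 1) ^- 2 *: expR x).
  by apply: is_deriveV; rewrite gt_eqF.
have D2 : is_derive x 1 (fun y : R => (expR y - 1) ^+ 2)
    (2 * (expR x - 1) * expR x).
  by apply: is_derive_eq; rewrite /GRing.scale /=; ring.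
have D2inv : is_derive x 1 (fun y : R => ((expR y - 1) ^+ 2)^-1)
    (- ((expR x - 1) ^+ 2) ^- 2 *: (2 * (expR x - 1) * expR x)).
  by apply: is_deriveV; rewrite gt_eqF ?exprn_gt0.
have DV : is_derive x 1 (fun y : R => y^-1) (- x ^- 2 *: (1 : R)).
  by apply: is_deriveV; rewrite gt_eqF.
apply: is_derive_eq.
rewrite /ddlnspecht /GRing.scale /=; field.
by rewrite !gt_eqF.
Qed.


Lemma derivable_cvg_right (f : R -> R) (x df : R) :
  is_derive x 1 f df -> f @ x^'+ --> f x.
Proof.
move=> [Df _]; apply/cvg_at_right_filter/differentiable_continuous.
exact/derivable1_diffP.
Qed.

Lemma derivable_cvg_left (f : R -> R) (x df : R) :
  is_derive x 1 f df -> f @ x^'- --> f x.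
Proof.
move=> [Df _]; apply/cvg_at_left_filter/differentiable_continuous.
exact/derivable1_diffP.
Qed.

(** Differentiability is only asked for on the open half-line because
    [lnspecht] is given by a singular formula at 0. *)
Lemma le_at0_of_derive (f df : R -> R) x :
  (forall y, 0 < y -> is_derive y 1 f (df y)) -> f @ 0^'+ --> f 0 ->
  (forall y, 0 < y -> 0 <= df y) -> 0 <= x -> f 0 <= f x.
Proof.
move=> Df c0 df0; rewrite le_eqVlt => /predU1P[<-//|x0].
have [||c] := @MVT R f df 0 x x0.
- by move=> y; rewrite in_itv/= => /andP[y0 _]; exact: Df.
- apply/continuous_within_itvP => //; split => //.
    move=> y; rewrite in_itv/= => /andP[/Df[Dy _] _].
    exact/differentiable_continuous/derivable1_diffP.
  exact: derivable_cvg_left (Df _ x0).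
rewrite in_itv/= => /andP[c1 _] e; rewrite -subr_ge0 e subr0.
by rewrite mulr_ge0 ?df0// ltW.
Qed.

(** The convex function exp has integral over [0, x] at most its trapezoidal
    value; equivalently tanh y <= y at y = x / 2. *)
Lemma expRm1_le_trapezoid x : 0 <= x -> 2 * (expR x - 1) <= x * (expR x + 1).
Proof.
move=> x0; rewrite -subr_ge0.
pose p := fun y : R => y * (expR y + 1) - 2 * (expR y - 1).
have Dp y : is_derive y 1 p (1 + (y - 1) * expR y).
  by apply: is_derive_eq; rewrite /GRing.scale /=; ring.
have -> : 0 = p 0 by rewrite /p expR0; ring.
apply: (le_at0_of_derive (fun y _ => Dp y)) => //.
  exact: derivable_cvg_right (Dp 0).
move=> y y0; have := expR_ge1Dx (- y); have := expR_gt0 y.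
have := expRxMexpNx_1 y; nra.
Qed.

(** The lower companion, by the midpoint rule; equivalently y <= sinh y at
    y = x / 2. *)
Lemma mul_expR_half_le x : 0 <= x -> x * expR (x / 2) <= expR x - 1.
Proof.
move=> x0.
pose q := fun y : R => expR (y / 2) - expR (- (y / 2)) - y.
have Dh y : is_derive y 1 (fun y : R => y / 2) 2^-1.
  by apply: is_derive_eq; rewrite /GRing.scale /=; ring.
have DhN y : is_derive y 1 (fun y : R => - (y / 2)) (- 2^-1).
  exact: is_deriveN.
have D1 y : is_derive y 1 (fun y => expR (y / 2)) (expR (y / 2) * 2^-1).
  exact: (@is_derive1_comp R (@expR R) _ y _ _ (is_derive_expR _) (Dh y)).
have D2 y : is_derive y 1 (fun y => expR (- (y / 2)))
    (expR (- (y / 2)) * - 2^-1).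
  exact: (@is_derive1_comp R (@expR R) _ y _ _ (is_derive_expR _) (DhN y)).
have Dq y : is_derive y 1 q ((expR (y / 2) + expR (- (y / 2))) / 2 - 1).
  by apply: is_derive_eq; rewrite /GRing.scale /=; field.
have : q 0 <= q x.
  apply: (le_at0_of_derive (fun y _ => Dq y)) => //.
    exact: derivable_cvg_right (Dq 0).
  move=> y y0.
  by have := expR_ge1Dx (y / 2); have := expR_ge1Dx (- (y / 2)); lra.
rewrite /q mul0r oppr0 subrr addr0 -(ler_pM2r (expR_gt0 (x / 2))) mul0r.
rewrite !mulrBl -expRD -splitr (mulrC (expR (- _))) expRxMexpNx_1.
by rewrite subr_ge0.
Qed.

(** Over the common denominator x^2 D^3, with E = e^x and D = E - 1, the
    numerator is D^3 - 3 x^2 E D + x^3 E (E + 1), and the middle term splits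
    into one share for each of the two estimates above. *)
Lemma ddlnspecht_ge0 x : 0 < x -> 0 <= ddlnspecht x.
Proof.
move=> x0; have trap := expRm1_le_trapezoid (ltW x0).
have half := mul_expR_half_le (ltW x0).
have d0 : 0 < expR x - 1 by rewrite subr_gt0 expR_gt1.
have e0 := expR_gt0 x.
have sq : x ^+ 2 * expR x <= (expR x - 1) ^+ 2.
  rewrite [X in _ * expR X]splitr expRD -expr2 -exprMn.
  by rewrite ler_pXn2r// nnegrE ?(ltW d0)// mulr_ge0 ?expR_ge0 ?ltW.
rewrite /ddlnspecht; move: trap sq d0 e0 {half}.
move: (expR x - 1) => D; move: (expR x) => E trap sq d0 e0.
have -> : (x ^+ 2)^-1 - 3 * E / D ^+ 2 + x * E * (E + 1) / D ^+ 3
  = (D * (D ^+ 2 - x ^+ 2 * E) + x ^+ 2 * E * (x * (E + 1) - 2 * D))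
    / (x ^+ 2 * D ^+ 3).
  by field; rewrite !gt_eqF.
have {x0}x0 := ltW x0; have {d0}d0 := ltW d0; have {e0}e0 := ltW e0.
by rewrite divr_ge0 ?addr_ge0 ?mulr_ge0 ?exprn_ge0 ?subr_ge0.
Qed.

Lemma lnspecht_cvg0 : lnspecht @ 0^'+ --> lnspecht 0.
Proof.
have -> : lnspecht 0 = 0 by rewrite /lnspecht eqxx.
apply: (@squeeze_cvgr _ _ _ _ (cst 0) id).
- near=> x; rewrite lnspecht_ge0 lnspecht_le//.
- exact: cvg_cst.
- exact/cvg_at_right_filter/cvg_id.
Unshelve. all: by end_near.
Qed.

Local Open Scope convex_scope.

(** Only [x <= y] is covered here because the second derivative criterion is
    about an interval; symmetry removes this in [lnspecht_convex]. *)
Lemma lnspecht_convex_le (t : {i01 R}) (x y : R^o) : 0 <= x -> x <= y ->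
  lnspecht (x <| t |> y) <= (lnspecht x : R^o) <| t |> (lnspecht y : R^o).
Proof.
move=> x0; rewrite le_eqVlt => /predU1P[<-|xy]; first by rewrite !convmm.
have DE (z : R) : 0 < z -> {near z, 'D_1 lnspecht =1 dlnspecht}.
  move=> z0; near=> w; apply: derive_val; apply: is_derive_lnspecht.
  near: w; exact: lt_nbhsr.
have xy' := ltW xy; apply: second_derivative_convex => //.
- move=> z /andP[xz zy]; have z0 : 0 < z by exact: le_lt_trans xz.
  rewrite (near_eq_derive _ (DE _ z0)).
  have [_ ->] := is_derive_dlnspecht z0; exact: ddlnspecht_ge0.
- exact: derivable_cvg_left (is_derive_lnspecht (le_lt_trans x0 xy)).
- move: x0 {xy xy'}; rewrite le_eqVlt => /predU1P[<-|x0].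
    exact: lnspecht_cvg0.
  exact: derivable_cvg_right (is_derive_lnspecht x0).
- move=> z; rewrite in_itv/= => /andP[xz _].
  by case: (is_derive_lnspecht (le_lt_trans x0 xz)).
- move=> z; rewrite in_itv/= => /andP[xz _]; have z0 := le_lt_trans x0 xz.
  apply: (near_eq_derivable (f := dlnspecht)).
    by near do apply/esym; exact: DE.
  by case: (is_derive_dlnspecht z0).
Unshelve. all: by end_near.
Qed.

(** Both sides vanish at 0 (the right one is 2 ln (cosh (x / 2))), and the
    derivatives compare by the arithmetic-geometric mean inequality. *)
Lemma lnspecht_le_cosh x : 0 <= x ->
  lnspecht x <= 2 * ln (expR x + 1) - x - 2 * ln 2.
Proof.
move=> x0; rewrite -subr_ge0.
pose g := fun y : R => 2 * ln (expR y + 1) - y - 2 * ln 2 - lnspecht y.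
have E1 y : 0 < expR y + 1 by rewrite addr_gt0 ?expR_gt0.
have D1 y : is_derive y 1 (fun y : R => expR y + 1) (expR y).
  by apply: is_derive_eq; rewrite addr0.
have Dl y : is_derive y 1 (@ln R \o (fun y : R => expR y + 1))
    ((expR y + 1)^-1 * expR y).
  exact: (@is_derive1_comp R (@ln R) _ y _ _ (is_derive1_ln (E1 y)) (D1 y)).
have Du y : is_derive y 1 (fun y : R => 2 * ln (expR y + 1) - y - 2 * ln 2)
    (2 * expR y / (expR y + 1) - 1).
  apply: is_derive_eq; rewrite /GRing.scale /=; field.
  by rewrite gt_eqF.
have Dg y : 0 < y ->
    is_derive y 1 g (2 * expR y / (expR y + 1) - 1 - dlnspecht y).
  by move=> /is_derive_lnspecht Dy; exact: is_deriveB.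
have -> : 0 = g 0.
  by rewrite /g expR0 /lnspecht eqxx -natr1 !subr0 subrr.
apply: (le_at0_of_derive Dg) => //.
  apply: cvgB; last exact: lnspecht_cvg0.
  exact: derivable_cvg_right (Du 0).
move=> y y0; rewrite subr_ge0 /dlnspecht.
have d0 : 0 < expR y - 1 by rewrite subr_gt0 expR_gt1.
have s0 := expR_gt0 (y / 2).
have E2 : expR y = expR (y / 2) ^+ 2 by rewrite -expRM_natr; congr expR; field.
have e0 := expR_gt0 y.
rewrite -subr_ge0.
set E := expR y in d0 e0 E2 *; set s := expR (y / 2) in s0 E2 *.
set D := E - 1 in d0 *.
have -> : 2 * E / (E + 1) - 1 - (D^-1 - y * E / D ^+ 2 - y^-1 + E / D)
  = ((E + 1) * (y ^+ 2 * E + D ^+ 2) - 4 * E * y * D) / (y * D ^+ 2 * (E + 1)).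
  by rewrite /D; field; rewrite -/D !gt_eqF// E1.
have {e0}e0 := addr_ge0 (ltW e0) (@ler01 R).
have {y0}y0 := ltW y0; have {d0}d0 := ltW d0; have {s0}s0 := ltW s0.
rewrite divr_ge0 ?mulr_ge0 ?exprn_ge0//.
(* The square is y^2 E + D^2 >= 2 y s D; the remainder is E + 1 >= 2 s. *)
have -> : (E + 1) * (y ^+ 2 * E + D ^+ 2) - 4 * E * y * D
  = (E + 1) * (y * s - D) ^+ 2 + 2 * y * D * s * (s - 1) ^+ 2.
  by rewrite E2; ring.
by apply: addr_ge0; apply: mulr_ge0; rewrite ?sqr_ge0 ?mulr_ge0.
Qed.

End LogSpecht.

(** * The weighted Specht function *)

Section WeightedSpecht.
Variable R : realType.
Local Open Scope convex_scope.

Lemma lnspecht_convex :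
  convex_function (`[0, +oo[%classic : set R^o) (@lnspecht R).
Proof.
move=> t x y; rewrite !inE /= !in_itv /= !andbT => x0 y0.
have [xy|/ltW yx] := leP x y; first exact: lnspecht_convex_le.
rewrite convC [leRHS]convC; exact: lnspecht_convex_le.
Qed.

(** This is [lnspecht_le_cosh] exponentiated; the bound is the Kantorovich
    constant, the square of the ratio of the arithmetic to the geometric mean
    of 1 and t. *)
Lemma specht_le_kantorovich (t : R) : 0 < t ->
  specht t <= (t + 1) ^+ 2 / (4 * t).
Proof.
move=> t0; have -> : t = expR (ln t) by rewrite lnK.
set x := ln t; rewrite specht_expR.
(* Both sides are invariant under [t -> 1 / t], that is [x -> - x]. *)
wlog x0 : x / 0 <= x => [hw|].
  have [/hw//|/ltW x0] := leP 0 x.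
  rewrite -lnspechtN; apply: le_trans (hw (- x) _) _; first by rewrite oppr_ge0.
  rewrite le_eqVlt; apply/orP; left; apply/eqP.
  by rewrite expRN; field; rewrite expR_eq0.
have e1 : 0 < expR x + 1 by rewrite addr_gt0 ?expR_gt0.
have := lnspecht_le_cosh x0; rewrite -ler_expR !expRB !(mulrC 2) !expRM_natr.
rewrite !lnK ?posrE//; move=> /le_trans; apply.
rewrite le_eqVlt; apply/orP; left; apply/eqP.
by field; rewrite expR_eq0.
Qed.

Variables a b : R.
Hypotheses (a0 : 0 < a) (b0 : 0 < b).
Let c := a^-1 * b.

Definition weighted_specht (u : R) : R :=
  specht (c `^ rfun 0 u) * a `^ (1 - u) * b `^ u.

Let f := weighted_specht.

Lemma weighted_specht0 : f 0 = a.
Proof.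
rewrite /f /weighted_specht /= subr0 min_l// !powRr0 powRr1 ?ltW// mulr1.
by rewrite /specht eqxx mul1r.
Qed.

Lemma weighted_specht1 : f 1 = b.
Proof.
rewrite /f /weighted_specht /= subrr min_r// !powRr0 powRr1 ?ltW// mulr1.
by rewrite /specht eqxx mul1r.
Qed.

(** Since S(t) = S(1/t), the sign of ln c is irrelevant inside S, so that only
    the half-line where [lnspecht] was shown convex is involved. *)
Lemma weighted_spechtE (u : R) : 0 <= rfun 0 u ->
  f u = a * expR (lnspecht (rfun 0 u * `|ln c|) + u * ln c).
Proof.
move=> r0; have c0 : 0 < c by rewrite mulr_gt0 ?invr_gt0.
have lnc : ln c = ln b - ln a.
  by rewrite /c mulrC lnM ?posrE ?invr_gt0// lnV.
rewrite /f /weighted_specht /powR !gt_eqF// specht_expR -mulrA -expRD -expRD.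
rewrite -{2}(lnK a0) -expRD; congr expR.
rewrite -lnspecht_norm normrM (ger0_norm r0); move: (lnspecht _) => k.
by rewrite lnc; ring.
Qed.

(** Where [rfun 0] is affine, the exponent in [weighted_spechtE] is convex, and
    so is its exponential. *)
Lemma weighted_specht_convex (D : set R^o) :
  (forall x, x \in D -> 0 <= rfun 0 x) ->
  (forall (t : {i01 R}) (x y : R^o), x \in D -> y \in D ->
    rfun 0 (x <| t |> y) = (rfun 0 x : R^o) <| t |> rfun 0 y) ->
  convex_function D (f : R^o -> R^o).
Proof.
move=> D_ge0 r_affine t x y xD yD.
have rx := D_ge0 _ xD; have ry := D_ge0 _ yD; have rxy := r_affine t _ _ xD yD.
have t0 : 0 <= t%:num by [].
have t1 : 0 <= 1 - t%:num by rewrite subr_ge0.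
have rc : 0 <= rfun 0 (x <| t |> y).
  by rewrite rxy convRE addr_ge0 ?mulr_ge0.
rewrite !weighted_spechtE//.
have L0 : 0 <= `|ln c| by [].
set L := `|ln c| in L0 *.
set kx := lnspecht (rfun 0 x * L); set ky := lnspecht (rfun 0 y * L).
have Kle : lnspecht (rfun 0 (x <| t |> y) * L) <= (kx : R^o) <| t |> ky.
  have -> : rfun 0 (x <| t |> y) * L
      = (rfun 0 x * L : R^o) <| t |> (rfun 0 y * L).
    by rewrite rxy !convRE; ring.
  by apply: lnspecht_convex; rewrite inE /= in_itv /= andbT mulr_ge0.
have -> : (a * expR (kx + x * ln c) : R^o) <| t |> (a * expR (ky + y * ln c))
    = a * ((expR (kx + x * ln c) : R^o) <| t |> expR (ky + y * ln c)).
  by rewrite !convRE; ring.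
rewrite ler_pM2l//; apply: le_trans (convex_expR _ _ _).
rewrite ler_expR; apply: le_trans (lerD Kle (lexx _)) _.
have -> : x <| t |> y = t%:num * x + (1 - t%:num) * y :> R by [].
rewrite le_eqVlt; apply/orP; left; apply/eqP.
by rewrite !convRE /unstable.onem; ring.
Qed.

Lemma weighted_specht_convexl :
  convex_function (`[0, 2^-1]%classic : set R^o) (f : R^o -> R^o).
Proof.
have rE (x : R) : x <= 2^-1 -> rfun 0 x = x.
  by move=> x2; rewrite /= min_l//; lra.
have inD (x : R) : x \in (`[0, 2^-1]%classic : set R^o) -> 0 <= x <= 2^-1.
  by rewrite inE /= in_itv.
apply: weighted_specht_convex => [x /inD/andP[x0 x2]|t x y].
  by rewrite rE.
move=> /inD/andP[x0 x2] /inD/andP[y0 y2]; rewrite (rE x)// (rE y)// rE//.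
have t0 : 0 <= t%:num by [].
have t1 : 0 <= 1 - t%:num by rewrite subr_ge0.
rewrite convRE /unstable.onem; nra.
Qed.

Lemma weighted_specht_convexr :
  convex_function (`[2^-1, 1]%classic : set R^o) (f : R^o -> R^o).
Proof.
have rE (x : R) : 2^-1 <= x -> rfun 0 x = 1 - x.
  by move=> x2; rewrite /= min_r//; lra.
have inD (x : R) : x \in (`[2^-1, 1]%classic : set R^o) -> 2^-1 <= x <= 1.
  by rewrite inE /= in_itv.
apply: weighted_specht_convex => [x /inD/andP[x2 x1]|t x y].
  by rewrite rE// subr_ge0.
move=> /inD/andP[x2 x1] /inD/andP[y2 y1]; rewrite (rE x)// (rE y)// rE.
  by rewrite !convRE /unstable.onem; ring.
have t0 : 0 <= t%:num by [].
have t1 : 0 <= 1 - t%:num by rewrite subr_ge0.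
rewrite convRE /unstable.onem; nra.
Qed.

Lemma weighted_specht_mid : 2 * f 2^-1 <= f 0 + f 1.
Proof.
rewrite weighted_specht0 weighted_specht1.
have c0 : 0 < c by rewrite mulr_gt0 ?invr_gt0.
have r2 : rfun 0 (2^-1 : R) = 2^-1 by rewrite /= min_l//; lra.
have h2 : 1 - 2^-1 = 2^-1 :> R by field.
rewrite /f /weighted_specht r2 h2; set p := c `^ 2^-1.
have p0 : 0 < p by exact: powR_gt0.
have p2 : p ^+ 2 = c.
  by rewrite -powR_mulrn ?ltW// -powRrM mulVf// powRr1// ltW.
have -> : b = a * c by rewrite /c mulrA mulfV ?gt_eqF// mul1r.
rewrite powRM ?(ltW a0) ?(ltW c0)// -/p -mulrA [a `^ _ * _]mulrA.
rewrite -powRD; last by rewrite gt_eqF ?implybT.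
have -> : 2^-1 + 2^-1 = 1 :> R by field.
rewrite powRr1 ?(ltW a0)// -p2.
have := specht_le_kantorovich p0; rewrite ler_pdivlMr ?mulr_gt0// => k.
have -> : 2 * (specht p * (a * p)) = a * (specht p * (4 * p)) / 2 by field.
have : a * (specht p * (4 * p)) <= a * (p + 1) ^+ 2 by rewrite ler_pM2l.
have := mulr_ge0 (ltW a0) (sqr_ge0 (p - 1)); lra.
Qed.

End WeightedSpecht.

Theorem theorem10 (R : realType) (a b v : R) (N : nat)
    (ha : 0 < a) (hb : 0 < b) (hv0 : 0 <= v) (hv1 : v <= 1) :
  let c := a^-1 * b in
  let f := fun u : R => specht (c `^ rfun 0 u) * a `^ (1 - u) * b `^ u in
  ((1 - v) * a + v * b
     >= specht (c `^ rfun 0 v) * a `^ (1 - v) * b `^ v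
        + \sum_(0 <= n < N) rfun n v *
            \sum_(1 <= k < (2 ^ n).+1)
              Delta f n k * \1_(open_dyadic n k) v)
  /\
  ((1 - v) * a + v * b
     <= a + b - a `^ v * b `^ (1 - v) * specht (c `^ rfun 0 v)
        - \sum_(0 <= n < N) rfun n v *
            \sum_(1 <= k < (2 ^ n).+1)
              Delta f n (2 ^ n - k + 1) * \1_(open_dyadic n k) v).
Proof.
move=> c f.
have v01 : 0 <= v <= 1 by rewrite hv0 hv1.
have w01 : 0 <= 1 - v <= 1 by lra.
have main u : 0 <= u <= 1 ->
    f u + \sum_(0 <= n < N) rfun n u *
        \sum_(1 <= k < (2 ^ n).+1) Delta f n k * \1_(open_dyadic n k) u
    <= (1 - u) * a + u * b.
  move=> u01; rewrite -[X in _ <= _ * X + _](weighted_specht0 b ha).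
  rewrite -[X in _ <= _ + _ * X](weighted_specht1 a hb).
  apply: faber_schauder_le => //.
  - exact: weighted_specht_convexl.
  - exact: weighted_specht_convexr.
  - exact: weighted_specht_mid.
split; first exact: main.
have {main} := main _ w01; rewrite subKr.
under eq_bigr => n _ do rewrite rfun_onem -layer_onem.
rewrite {1}/f rfun_onem subKr.
have -> : specht (c `^ rfun 0 v) * a `^ v * b `^ (1 - v)
  = a `^ v * b `^ (1 - v) * specht (c `^ rfun 0 v) by ring.
lra.
Qed.
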